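(* Let $k>0$, $b_0\le 0$, $c,m\in\mathbb{R}$, $U:=c-m$, and assume that $m\neq0$. Consider any particle $(a,b)$ with $a\in\mathbb{R}$, $b\le b_0$, moving along the path $t\mapsto (X(t,a,b),Z(t,a,b))$ given in the context. The signed horizontal drift of the particle within a period is $$d=\frac{2\pi U}{k\,m\,\operatorname{sign}(m)}.$$
   Context: The particle paths are, for $t\ge 0$, $a\in\mathbb{R}$, $b\le b_0$, $$X(t,a,b):=a+(c-m)t-\frac{e^{kb}}{k}\sin(k(a-mt)),\qquad Z(t,a,b):=b+\frac{e^{kb}}{k}\cos(k(a-mt)).$$ The free surface at time $t$ is the curve $a\mapsto(X(t,a,b_0),Z(t,a,b_0))$; it is the graph of a function of $X-ct$ with minimal period $2\pi/k$. Its crests are located at $X=ct+2\pi n/k$, $n\in\mathbb{Z}$; the crest lines at time $t$ are the vertical lines through the crests. The signed horizontal drift of a particle is the signed horizontal distance $X(t_2,a,b)-X(t_1,a,b)$ moved by the particle between its positions on two consecutive crest lines, i.e. where $t_1<t_2$ are two consecutive times at which the particle lies on a crest line. *)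

(* Defs.v *)
From Stdlib Require Import Reals Lra Lia.
From Coquelicot Require Import Coquelicot.
Open Scope R_scope.

Definition path_X (k c m t a b : R) : R :=
  a + (c - m) * t - exp (k * b) / k * sin (k * (a - m * t)).

Definition path_Z (k m t a b : R) : R :=
  b + exp (k * b) / k * cos (k * (a - m * t)).

Definition on_free_surface (k c m b0 t x z : R) : Prop :=
  exists a : R, x = path_X k c m t a b0 /\ z = path_Z k m t a b0.

(* A crest is a highest point of the surface profile; [crest_location] below
   gives the explicit positions. *)
Definition is_crest (k c m b0 t x z : R) : Prop :=
  on_free_surface k c m b0 t x z /\
  forall x' z' : R, on_free_surface k c m b0 t x' z' -> z' <= z.

(* The crest lines at time t are vertical, so only the abscissa x matters. *)
Definition on_crest_line (k c m b0 t x : R) : Prop :=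
  exists z : R, is_crest k c m b0 t x z.

Definition particle_on_crest_line (k c m b0 a b t : R) : Prop :=
  on_crest_line k c m b0 t (path_X k c m t a b).

Definition consecutive_crest_times (k c m b0 a b t1 t2 : R) : Prop :=
  0 <= t1 /\ t1 < t2 /\
  particle_on_crest_line k c m b0 a b t1 /\
  particle_on_crest_line k c m b0 a b t2 /\
  (forall t : R, t1 < t < t2 -> ~ particle_on_crest_line k c m b0 a b t).

(* Relational, since the drift presupposes that consecutive crest times exist
   and that the distance does not depend on which pair is chosen. *)
Definition is_signed_horizontal_drift (k c m b0 a b d : R) : Prop :=
  (exists t1 t2 : R, consecutive_crest_times k c m b0 a b t1 t2) /\
  (forall t1 t2 : R, consecutive_crest_times k c m b0 a b t1 t2 ->
     path_X k c m t2 a b - path_X k c m t1 a b = d).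

Lemma cos_eq_1_inv (x : R) : cos x = 1 -> exists n : Z, x = 2 * PI * IZR n.
Proof.
intros H.
assert (Hs : sin (x / 2) = 0).
{ pose proof (cos_2a_sin (x / 2)) as E.
  replace (2 * (x / 2)) with x in E by field. nra. }
destruct (sin_eq_0_0 _ Hs) as [n Hn].
exists n. lra.
Qed.

Lemma sin_cos_2PI_IZR (n : Z) :
  sin (2 * PI * IZR n) = 0 /\ cos (2 * PI * IZR n) = 1.
Proof.
assert (Hs : sin (IZR n * PI) = 0) by (apply sin_eq_0_1; now exists n).
replace (2 * PI * IZR n) with (2 * (IZR n * PI)) by ring.
rewrite sin_2a, cos_2a_sin, Hs. lra.
Qed.

Lemma crest_location (k c m b0 t x : R) : 0 < k ->
  on_crest_line k c m b0 t x <->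
  exists n : Z, x = c * t + 2 * PI * IZR n / k.
Proof.
intros Hk.
assert (He : 0 < exp (k * b0) / k)
  by (apply Rdiv_lt_0_compat; [apply exp_pos | exact Hk]).
split.
- intros [z [[a [Hx Hz]] Hmax]].
  assert (H0 := Hmax _ _ (ex_intro _ (m * t) (conj eq_refl eq_refl))).
  rewrite Hz in H0. unfold path_Z in H0.
  replace (k * (m * t - m * t)) with 0 in H0 by ring. rewrite cos_0 in H0.
  assert (Hc : cos (k * (a - m * t)) = 1).
  { pose proof (COS_bound (k * (a - m * t))). nra. }
  destruct (cos_eq_1_inv _ Hc) as [n Hn].
  exists n. rewrite Hx. unfold path_X. rewrite Hn.
  rewrite (proj1 (sin_cos_2PI_IZR n)), <- Hn. field. lra.
- intros [n Hn].
  set (a := m * t + 2 * PI * IZR n / k).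
  assert (Ha : k * (a - m * t) = 2 * PI * IZR n) by (unfold a; field; lra).
  exists (path_Z k m t a b0). split.
  + exists a. split; [|reflexivity].
    unfold path_X. rewrite Ha, (proj1 (sin_cos_2PI_IZR n)), Hn. unfold a. ring.
  + intros x' z' [a' [_ ->]]. unfold path_Z.
    rewrite Ha, (proj2 (sin_cos_2PI_IZR n)).
    pose proof (COS_bound (k * (a' - m * t))). nra.
Qed.

(* Main.v *)
(** A particle lies on a crest line exactly when its phase [theta = k (a - m t)]
    satisfies [theta - exp (k b) sin theta = 2 pi n]. As [exp (k b) <= 1], the only
    solution is [theta = 2 pi n], so the crest times form an arithmetic progression
    of step [2 pi / (k |m|)]. The oscillating part of [X] vanishes at these times,
    and only the uniform drift with speed [U] contributes. *)

Require Import Defs.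
From Stdlib Require Import Reals Lra Lia.
From Coquelicot Require Import Coquelicot.
Open Scope R_scope.

(** Away from 0, [sin y] is strictly smaller than [y] in absolute value, and a factor [q <= 1]
    cannot make up for it. The strictness covers [q = 1], which occurs for [b = 0]. *)
Lemma eq_mul_sin_0 (q y : R) : 0 <= q <= 1 -> y = q * sin y -> y = 0.
Proof.
intros Hq Hy.
destruct (Rtotal_order y 0) as [Hneg | [H0 | Hpos]]; [| exact H0 |].
- pose proof (sin_lt_x (- y) ltac:(lra)) as Hs. rewrite sin_neg in Hs.
  destruct (Rle_lt_dec 0 (sin y)); nra.
- pose proof (sin_lt_x y Hpos). destruct (Rle_lt_dec 0 (sin y)); nra.
Qed.

Lemma sin_sub_2PI_IZR (x : R) (n : Z) : sin (x - 2 * PI * IZR n) = sin x.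
Proof.
destruct (sin_cos_2PI_IZR n) as [Hs Hc].
rewrite sin_minus, Hs, Hc. ring.
Qed.

Lemma particle_on_crest_line_phase (k c m b0 a b t : R) : 0 < k -> b <= 0 ->
  particle_on_crest_line k c m b0 a b t <->
  exists n : Z, k * (a - m * t) = 2 * PI * IZR n.
Proof.
intros Hk Hb. unfold particle_on_crest_line, path_X.
rewrite (crest_location k c m b0 t _ Hk).
split; intros [n Hn]; exists n.
- assert (Hq : exp (k * b) <= 1).
  { rewrite <- exp_0. destruct (Rle_lt_or_eq_dec (k * b) 0) as [H | H].
    - nra.
    - left. now apply exp_increasing.
    - rewrite H. lra. }
  pose proof (exp_pos (k * b)) as Hq0.
  (* Removing the full turns leaves the sine unchanged, so the reduced phase [y] satisfies
     [y = exp (k * b) * sin y]. *)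
  enough (k * (a - m * t) - 2 * PI * IZR n = 0) by lra.
  apply (eq_mul_sin_0 (exp (k * b))); [lra |].
  rewrite sin_sub_2PI_IZR.
  assert (E : k * (a + (c - m) * t - exp (k * b) / k * sin (k * (a - m * t)))
              = k * (c * t + 2 * PI * IZR n / k)) by now rewrite Hn.
  field_simplify in E; lra.
- rewrite Hn, (proj1 (sin_cos_2PI_IZR n)).
  apply (Rmult_eq_reg_l k); [| lra]. field_simplify; lra.
Qed.

Lemma particle_on_crest_line_time (k c m b0 a b t : R) :
  0 < k -> m <> 0 -> b <= 0 ->
  particle_on_crest_line k c m b0 a b t <->
  exists n : Z, t = a / m + IZR n * (2 * PI / (k * Rabs m)).
Proof.
intros Hk Hm Hb. rewrite particle_on_crest_line_phase by assumption.
unfold Rabs. destruct (Rcase_abs m) as [Hneg | Hpos].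
- split; intros [n Hn]; exists n.
  + replace (IZR n * (2 * PI / (k * - m))) with (- (2 * PI * IZR n) / (k * m))
      by (field; lra).
    rewrite <- Hn. field. lra.
  + rewrite Hn. field. lra.
(* For [m > 0] the phase decreases in time, so the index changes sign. *)
- split; intros [n Hn]; exists (- n)%Z; rewrite opp_IZR.
  + replace (- IZR n * (2 * PI / (k * m))) with (- (2 * PI * IZR n) / (k * m))
      by (field; lra).
    rewrite <- Hn. field. lra.
  + rewrite Hn. field. lra.
Qed.

Lemma path_X_on_crest_line (k c m b0 a b t : R) : 0 < k -> b <= 0 ->
  particle_on_crest_line k c m b0 a b t ->
  path_X k c m t a b = a + (c - m) * t.
Proof.
intros Hk Hb H.
apply (particle_on_crest_line_phase k c m b0 a b t Hk Hb) in H.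
destruct H as [n Hn]. unfold path_X.
rewrite Hn, (proj1 (sin_cos_2PI_IZR n)). ring.
Qed.

(** If the indices of [t1] and [t2] differed by more than 1, the successor of [t1] in the
    progression would lie strictly between them. *)
Lemma progression_consecutive (P : R -> Prop) (t0 T t1 t2 : R) :
  0 < T -> (forall t, P t <-> exists n : Z, t = t0 + IZR n * T) ->
  P t1 -> P t2 -> t1 < t2 -> (forall t, t1 < t < t2 -> ~ P t) -> t2 - t1 = T.
Proof.
intros HT HP H1 H2 H12 Hno.
apply HP in H1, H2. destruct H1 as [n1 H1], H2 as [n2 H2].
assert (Hlt : (n1 < n2)%Z) by (apply lt_IZR; nra).
destruct (Z.eq_dec n2 (n1 + 1)) as [-> | Hne].
- rewrite plus_IZR in H2. lra.
- exfalso. assert (Hlt' : (n1 + 1 < n2)%Z) by lia.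
  apply IZR_lt in Hlt'. rewrite plus_IZR in Hlt'.
  apply (Hno (t0 + IZR (n1 + 1) * T)).
  + rewrite plus_IZR. nra.
  + apply HP. now exists (n1 + 1)%Z.
Qed.

(** Otherwise the integer [p] would lie strictly between [n] and [n + 1]. *)
Lemma progression_gap (t0 T t : R) (n p : Z) : 0 < T ->
  t0 + IZR n * T < t < t0 + IZR (n + 1) * T -> t <> t0 + IZR p * T.
Proof.
intros HT [H1 H2] ->.
assert (n < p)%Z by (apply lt_IZR; nra).
assert (p < n + 1)%Z by (apply lt_IZR; nra).
lia.
Qed.

Lemma progression_ge0 (t0 T : R) : 0 < T -> exists n : Z, 0 <= t0 + IZR n * T.
Proof.
(* The progression crosses 0 at the real index [- t0 / T], and [up] gives an integer above it. *)
intros HT. exists (up (- t0 / T)).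
destruct (archimed (- t0 / T)) as [H _].
apply (Rmult_gt_compat_r T) in H; [| exact HT].
replace (- t0 / T * T) with (- t0) in H by (field; lra). lra.
Qed.

Lemma mul_sign (x : R) : x * sign x = Rabs x.
Proof.
destruct (Rtotal_order x 0) as [H | [-> | H]].
- rewrite sign_eq_m1, Rabs_left by assumption. ring.
- rewrite Rabs_R0. ring.
- rewrite sign_eq_1, Rabs_right by lra. ring.
Qed.

Theorem proposition4p1 (k b0 c m U a b : R)
    (hk : 0 < k) (hb0 : b0 <= 0) (hU : U = c - m) (hm : m <> 0) (hb : b <= b0) :
  is_signed_horizontal_drift k c m b0 a b (2 * PI * U / (k * m * sign m)).
Proof.
assert (hb' : b <= 0) by lra.
assert (Habs : 0 < Rabs m) by now apply Rabs_pos_lt.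
rewrite (Rmult_assoc k), mul_sign.
pose proof (fun t => particle_on_crest_line_time k c m b0 a b t hk hm hb') as Htime.
assert (HT : 0 < 2 * PI / (k * Rabs m)).
{ apply Rdiv_lt_0_compat; [pose proof PI_RGT_0; lra | nra]. }
split.
(* Existence: a crest time that is not negative, followed by the next term of the progression. *)
- destruct (progression_ge0 (a / m) _ HT) as [n Hn].
  exists (a / m + IZR n * (2 * PI / (k * Rabs m))),
    (a / m + IZR (n + 1) * (2 * PI / (k * Rabs m))).
  split; [exact Hn |]. split; [rewrite plus_IZR; lra |].
  split; [apply Htime; now exists n |].
  split; [apply Htime; now exists (n + 1)%Z |].
  intros t Ht Hc. apply Htime in Hc. destruct Hc as [p Hp].
  exact (progression_gap _ _ _ _ _ HT Ht Hp).
(* Independence of the pair: every gap equals the step, during which the uniform drift covers [U]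
   times the step. *)
- intros t1 t2 (_ & H12 & H1 & H2 & Hno).
  pose proof (progression_consecutive _ _ _ _ _ HT Htime H1 H2 H12 Hno) as Hgap.
  rewrite (path_X_on_crest_line k c m b0 a b t1 hk hb' H1).
  rewrite (path_X_on_crest_line k c m b0 a b t2 hk hb' H2).
  replace (2 * PI * U / (k * Rabs m)) with (U * (2 * PI / (k * Rabs m)))
    by (field; lra).
  rewrite <- Hgap, hU. ring.
Qed.
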